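(* Let $X$ be a Banach space, let $A,B,C,D\in\mathcal L(X)$ and let $M=\begin{bmatrix}A&B\\ C&D\end{bmatrix}\in M_2(\mathcal L(X))$. Suppose that $A$ and $D$ have strongly Drazin inverses. If $A^DBCA^D=0$, $A^DBD=0$, $A^{\pi}BC=0$ and $A^{\pi}BD=0$, then $M$ has Hirano inverse.
   Context: $\mathcal L(X)$ is the Banach algebra of all bounded linear operators on the Banach space $X$; $I$ is the identity operator. $M_2(\mathcal L(X))$ is the algebra of $2\times 2$ matrices over $\mathcal L(X)$ (bounded operators on $X\oplus X$). Let $\mathcal R$ be $\mathcal L(X)$ or $M_2(\mathcal L(X))$ and $T\in\mathcal R$. - $T$ has Drazin inverse if there is $Z\in\mathcal R$ with $TZ=ZT$, $Z=ZTZ$ and $T-T^2Z$ nilpotent; such $Z$ is unique if it exists and is denoted $T^D$. (The superscript $D$ denotes the Drazin inverse and is unrelated to the block $D$.) - $T$ has strongly Drazin inverse if there is $Z\in\mathcal R$ with $TZ=ZT$, $Z=ZTZ$ and $T-TZ$ nilpotent; such $Z$ is unique, and it is then also the Drazin inverse $T^D$. - $T$ has Hirano inverse if there is $Z\in\mathcal R$ with $TZ=ZT$, $Z=ZTZ$ and $T^2-TZ$ nilpotent. For $T$ with Drazin inverse, $T^{\pi}=I-TT^D$. *)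

(* Defs.v *)
From HB Require Import structures.
From mathcomp Require Import all_boot all_order all_algebra.
From mathcomp Require Import boolp classical_sets functions.
From mathcomp Require Import interval_inference reals topology normedtype.

Set Implicit Arguments.
Unset Strict Implicit.
Unset Printing Implicit Defensive.

Import Order.TTheory GRing.Theory Num.Theory.
Import numFieldNormedType.Exports.

Local Open Scope classical_set_scope.
Local Open Scope ring_scope.

Section BoundedOperators.
Context (K : numFieldType) (X : normedModType K).

Definition bounded_linear (f : X -> X) : Prop :=
  linear f /\ exists2 c : K, 0 <= c & forall x, `|f x| <= c * `|x|.

Definition bounded_linear_pred : {pred X -> X} :=
  fun f => `[< bounded_linear f >].

Lemma bounded_linear_zmod_closed : zmod_closed bounded_linear_pred.
Proof.
split=> [|f g]; first apply/asboolP.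
  split=> [a x y|]; first by rewrite scaler0 addr0.
  by exists 0 => // x; rewrite normr0 mul0r.
move=> /asboolP[fL [c c0 fc]] /asboolP[gL [d d0 gd]].
apply/asboolP; split=> [a x y|].
  have E u : (f - g) u = f u - g u by [].
  by rewrite !E fL gL scalerBr opprD !addrA (addrAC _ (f y)).
exists (c + d); first exact: addr_ge0.
by move=> x; rewrite mulrDl (le_trans (ler_normB _ _))// lerD.
Qed.

HB.instance Definition _ :=
  GRing.isZmodClosed.Build (X -> X) bounded_linear_pred
    bounded_linear_zmod_closed.

Lemma bounded_linear_id : id \in bounded_linear_pred.
Proof.
by apply/asboolP; split=> //; exists 1 => // x; rewrite mul1r.
Qed.

Lemma bounded_linear_comp (f g : X -> X) : f \in bounded_linear_pred ->
  g \in bounded_linear_pred -> f \o g \in bounded_linear_pred.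
Proof.
move=> /asboolP[fL [c c0 fc]] /asboolP[gL [d d0 gd]].
apply/asboolP; split=> [a x y|]; first by rewrite /= gL fL.
exists (c * d); first exact: mulr_ge0.
by move=> x; rewrite /= (le_trans (fc _))// -mulrA ler_wpM2l.
Qed.

Record bounded_op := BoundedOp {
  bounded_op_fun :> X -> X;
  bounded_op_funP : bounded_op_fun \in bounded_linear_pred }.

HB.instance Definition _ := [isSub of bounded_op for bounded_op_fun].
HB.instance Definition _ := [Choice of bounded_op by <:].
HB.instance Definition _ := [SubChoice_isSubZmodule of bounded_op by <:].

Definition bounded_op_id : bounded_op := BoundedOp bounded_linear_id.

Definition bounded_op_comp (f g : bounded_op) : bounded_op :=
  BoundedOp (bounded_linear_comp (bounded_op_funP f) (bounded_op_funP g)).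

Lemma bounded_op_ext (f g : bounded_op) : (f : X -> X) =1 g -> f = g.
Proof. by move=> fg; apply/val_inj/funext. Qed.

Lemma bounded_op_linear (f : bounded_op) : linear f.
Proof. by have /asboolP[] := bounded_op_funP f. Qed.

HB.instance Definition _ (f : bounded_op) :=
  GRing.isLinear.Build K X X *:%R (bounded_op_fun f) (@bounded_op_linear f).

Lemma bounded_op_compA : associative bounded_op_comp.
Proof. by move=> f g h; apply: bounded_op_ext. Qed.

Lemma bounded_op_comp1f : left_id bounded_op_id bounded_op_comp.
Proof. by move=> f; apply: bounded_op_ext. Qed.

Lemma bounded_op_compf1 : right_id bounded_op_id bounded_op_comp.
Proof. by move=> f; apply: bounded_op_ext. Qed.

Lemma bounded_op_compDl : left_distributive bounded_op_comp +%R.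
Proof. by move=> f g h; apply: bounded_op_ext. Qed.

Lemma bounded_op_compDr : right_distributive bounded_op_comp +%R.
Proof. by move=> f g h; apply: bounded_op_ext => x; exact: raddfD. Qed.

(* Only a [pzRingType]: when X is the zero space, 0 = 1 in L(X). *)
HB.instance Definition _ := GRing.Zmodule_isPzRing.Build bounded_op
  bounded_op_compA bounded_op_comp1f bounded_op_compf1
  bounded_op_compDl bounded_op_compDr.

Lemma bounded_op_mulE (f g : bounded_op) (x : X) : (f * g) x = f (g x).
Proof. by []. Qed.

Lemma bounded_op_1E (x : X) : (1 : bounded_op) x = x.
Proof. by []. Qed.

End BoundedOperators.

Notation "''L' ( X )" := (bounded_op X) (at level 8, format "''L' ( X )").

Section GeneralizedInverses.
Context (R : pzRingType).
Implicit Types t z : R.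

Definition nilpotent_elt t : Prop := exists n : nat, t ^+ n = 0.

Definition is_drazin_inverse t z : Prop :=
  [/\ t * z = z * t, z = z * t * z & nilpotent_elt (t - t ^+ 2 * z)].

Definition is_strongly_drazin_inverse t z : Prop :=
  [/\ t * z = z * t, z = z * t * z & nilpotent_elt (t - t * z)].

Definition is_hirano_inverse t z : Prop :=
  [/\ t * z = z * t, z = z * t * z & nilpotent_elt (t ^+ 2 - t * z)].

Definition has_strongly_drazin_inverse t : Prop :=
  exists z, is_strongly_drazin_inverse t z.

Definition has_hirano_inverse t : Prop := exists z, is_hirano_inverse t z.

(* Junk value 0 when [t] has no Drazin inverse. *)
Definition drazin t : R := xget 0 [set z | is_drazin_inverse t z].

Definition spectral_idem t : R := 1 - t * drazin t.

Lemma idem_expS (e : R) n : e * e = e -> e ^+ n.+1 = e.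
Proof. by move=> ee; elim: n => // n IH; rewrite exprS IH. Qed.

Lemma drazin_idem t z : z = z * t * z -> t * z * (t * z) = t * z.
Proof. by move=> zE; rewrite -mulrA [z * _]mulrA -zE. Qed.

Lemma drazin_expr t z n : t * z = z * t -> z = z * t * z ->
  t ^+ n.+1 * z ^+ n.+1 = t * z.
Proof.
by move=> tz zE; rewrite -exprMn_comm// idem_expS//; exact: drazin_idem.
Qed.

Lemma drazin_nilp t z : is_drazin_inverse t z ->
  exists n, forall m, (n <= m)%N -> t ^+ m * (1 - t * z) = 0.
Proof.
move=> [tz zE [n tn]]; exists n => m nm.
have ee := drazin_idem zE; set e := t * z in ee *.
have te : GRing.comm t e by rewrite /GRing.comm /e {1}tz !mulrA.
have e1 : (1 - e) * (1 - e) = 1 - e.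
  by rewrite mulrBl mul1r mulrBr mulr1 ee subrr subr0.
have E : t - t ^+ 2 * z = t * (1 - e) by rewrite mulrBr mulr1 mulrA.
have c1 : GRing.comm t (1 - e) by apply: commrB => //; exact: commr1.
have E0 : t ^+ n.+1 * (1 - e) = 0.
  by rewrite -(idem_expS n e1) -exprMn_comm// -E exprS tn mulr0.
case: (ltngtP n m) nm => // [nm _|<- _].
  by rewrite -(subnK nm) exprD -mulrA E0 mulr0.
case: n tn E0 => [|n] tn E0; last first.
  by rewrite -(idem_expS n e1) -exprMn_comm// -E tn.
by move: tn; rewrite !expr0 => R0; rewrite R0 mul0r.
Qed.

Lemma drazin_uniq t y z :
  is_drazin_inverse t y -> is_drazin_inverse t z -> y = z.
Proof.
move=> ty tz.
have [n nP] := drazin_nilp ty; have [m mP] := drazin_nilp tz.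
move: ty tz => [ty yE _] [tz zE _].
have n1 : t ^+ (n + m).+1 * (1 - t * y) = 0.
  by apply: nP; rewrite -addnS leq_addr.
have m1 : t ^+ (n + m).+1 * (1 - t * z) = 0.
  by apply: mP; rewrite -addSn leq_addl.
have exy u v : t * u = u * t -> u = u * t * u ->
    t ^+ (n + m).+1 * (1 - v) = 0 -> t * u = t * u * v.
  move=> tu uE t0; apply/eqP; rewrite -subr_eq0 -{1}[t * u]mulr1 -mulrBr.
  rewrite -(drazin_expr (n + m) tu uE).
  have -> : t ^+ (n + m).+1 * u ^+ (n + m).+1 =
      u ^+ (n + m).+1 * t ^+ (n + m).+1.
    by apply: commrX; apply/commr_sym/commrX/commr_sym.
  by rewrite -mulrA t0 mulr0.
have e1 : t * y = t * y * (t * z) by exact: exy.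
have e2 : t * z = t * y * (t * z).
  have c : GRing.comm (t ^+ (n + m).+1) (1 - t * y).
    apply: commrB; [exact: commr1|apply/commr_sym/commrX/commr_sym].
    by rewrite /GRing.comm {1}ty !mulrA.
  apply/eqP; rewrite -subr_eq0 -{1}[t * z]mul1r -mulrBl.
  by rewrite -(drazin_expr (n + m) tz zE) mulrA -c n1 mul0r.
have ef : t * y = t * z by rewrite e1 -e2.
by rewrite yE -mulrA ef mulrA -ty ef tz -zE.
Qed.

Lemma drazinE t z : is_drazin_inverse t z -> drazin t = z.
Proof.
move=> tz; rewrite /drazin; case: xgetP => [y _ ty|/(_ z)]; last by [].
exact: drazin_uniq ty tz.
Qed.

Lemma strongly_drazin_is_drazin t z :
  is_strongly_drazin_inverse t z -> is_drazin_inverse t z.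
Proof.
move=> [tz zE [n tn]]; split=> //; exists n.
have ee := drazin_idem zE; set e := t * z in ee *.
have te : GRing.comm t e by rewrite /GRing.comm /e {1}tz !mulrA.
have -> : t - t ^+ 2 * z = (t - e) * (1 - e).
  by rewrite mulrBr mulr1 mulrBl ee opprB addrA subrK mulrA.
have c : GRing.comm (t - e) (1 - e).
  by apply/commr_sym/commrB; apply/commr_sym/commrB; rewrite //;
    exact: commr1.
by rewrite exprMn_comm// tn mul0r.
Qed.

End GeneralizedInverses.

(* Main.v *)
Require Import Defs.
From HB Require Import structures.
From mathcomp Require Import all_boot all_order all_algebra.
From mathcomp Require Import reals topology normedtype.

Set Implicit Arguments.
Unset Strict Implicit.
Unset Printing Implicit Defensive.

Import GRing.Theory.

Local Open Scope ring_scope.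

(** The hypotheses simplify. With E = A A^D, the identity 1 = A A^D + A^pi
    turns them into B D = 0, E B C = B C and B C E = 0; in particular
    (B C)^2 = B C E B C = 0, so both B C and C B are nilpotent.

    An element t of any ring has a strongly Drazin inverse if and only if
    t - t^2 is nilpotent, and a strongly Drazin inverse is a Hirano inverse
    because t^2 - t z = (t - t z) (t + t z). So it suffices to show that
    M - M^2 is nilpotent. The class of all t with t - t^2 nilpotent contains
    the nilpotent elements and is closed under sums p + q with p q = 0
    ([nilpotent_subsqrD]). Split M as

      [A (1 - E), B; C (1 - E), 0] + [A E, 0; C E, D].

    The product of the two summands in this order is zero by B C E = 0,
    B D = 0 and E (1 - E) = 0. The second summand is lower triangular and its
    diagonal entries are in the class, hence so is the summand itself. The
    first one is nilpotent: its diagonal part S is nilpotent because A (1 - E)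
    is, its antidiagonal part T is nilpotent because B C is, and
    A (1 - E) B C = 0 gives S T (S + T) = 0, which makes S + T nilpotent
    ([nilpotentD]). *)

(** * Nilpotent elements and strongly Drazin inverses *)

Section Nilpotent.
Context (R : pzRingType).
Implicit Types s t p q : R.

Lemma nilpotent0 : nilpotent_elt (0 : R).
Proof. by exists 1%N; rewrite expr1. Qed.

Lemma nilpotentM_comm s t :
  GRing.comm s t -> nilpotent_elt s -> nilpotent_elt (s * t).
Proof. by move=> st [n sn]; exists n; rewrite exprMn_comm// sn mul0r. Qed.

(** With w = s + t the hypothesis reads s w w = s s w, so that
    s w^(k+1) = s^(k+1) w and s kills the high powers of w from the left. On
    such a power, multiplication by w is multiplication by t. *)
Lemma nilpotentD s t : s * t * (s + t) = 0 ->
  nilpotent_elt s -> nilpotent_elt t -> nilpotent_elt (s + t).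
Proof.
set w := s + t => stw [m sm] [n tn].
have swE : s * w = s * s + s * t by rewrite -mulrDr.
have sw k : s * w ^+ k.+1 = s ^+ k.+1 * w.
  elim: k => [|k IH]; first by rewrite !expr1.
  have sww : s * w * w = s * s * w by rewrite swE [LHS]mulrDl stw addr0.
  rewrite exprSr mulrA IH [in RHS]exprSr exprSr -!mulrA; congr (_ * _).
  by rewrite !mulrA.
have wt k : w ^+ k * w ^+ m.+1 = t ^+ k * w ^+ m.+1.
  elim: k => [|k IH]; first by rewrite !expr0.
  rewrite [t ^+ _]exprS -mulrA -IH -!exprD addSn exprS {1}/w mulrDl.
  by rewrite addnS sw -addnS exprD exprSr sm mul0r mulr0 mul0r add0r.
by exists (n + m.+1)%N; rewrite exprD wt tn mul0r.
Qed.

Lemma nilpotent_subsqr t : nilpotent_elt t -> nilpotent_elt (t - t ^+ 2).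
Proof.
move=> tn; have -> : t - t ^+ 2 = t * (1 - t) by rewrite mulrBr mulr1.
by apply: nilpotentM_comm => //; apply: commrB => //; exact: commr1.
Qed.

(** Put w = p + q. Then w - w^2 = (p - p^2) + q (1 - w) with the product of
    the two terms zero, and w q = q q shows that the powers of q (1 - w) are
    those of q - q^2 up to the last factor. *)
Lemma nilpotent_subsqrD p q : p * q = 0 -> nilpotent_elt (p - p ^+ 2) ->
  nilpotent_elt (q - q ^+ 2) -> nilpotent_elt ((p + q) - (p + q) ^+ 2).
Proof.
move=> pq pn [n qn]; set w := p + q.
have -> : w - w ^+ 2 = (p - p ^+ 2) + q * (1 - w).
  by rewrite expr2 {2}/w mulrDl [p * w]mulrDr pq addr0 mulrBr mulr1 opprD addrACA.
have pq0 : (p - p ^+ 2) * q = 0 by rewrite mulrBl -mulrA pq mulr0 subrr.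
apply: nilpotentD => //; first by rewrite mulrA pq0 !mul0r.
have qw : q * (1 - w) * q = (q - q ^+ 2) * q.
  have wq : w * q = q * q by rewrite [LHS]mulrDl pq add0r.
  by rewrite -mulrA [(1 - w) * q]mulrBl mul1r wq mulrBr mulrBl mulrA.
have qwX k : (q * (1 - w)) ^+ k.+1 = (q - q ^+ 2) ^+ k * (q * (1 - w)).
  elim: k => [|k IH]; first by rewrite expr0 expr1 mul1r.
  by rewrite exprSr IH (exprSr _ k) -!mulrA; congr (_ * _); rewrite !mulrA qw.
by exists n.+1; rewrite qwX qn mul0r.
Qed.

Lemma subrDM_idem t e :
  GRing.comm t e -> e * e = e -> (t - e) * (t + e) = t ^+ 2 - e.
Proof. by move=> te ee; rewrite mulrBl !mulrDr ee te opprD addrA addrK. Qed.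

Lemma strongly_drazin_subsqr t z :
  is_strongly_drazin_inverse t z -> nilpotent_elt (t - t ^+ 2).
Proof.
move=> [tz zE tn]; have ee := drazin_idem zE; set e := t * z in tn ee *.
have te : GRing.comm t e by rewrite /GRing.comm /e {1}tz !mulrA.
have -> : t - t ^+ 2 = (t - e) * (1 - (t + e)).
  by rewrite mulrBr mulr1 subrDM_idem// opprB addrA subrK.
apply: nilpotentM_comm tn; apply: commrB; first exact: commr1.
by apply: commrD; apply/commr_sym; apply: commrB.
Qed.

(** With N such that (t - t^2)^N = 0, the element e = 1 - (1 - t^N)^N is a
    multiple of t^N and 1 - e is a multiple of (1 - t)^N, so e (1 - e) = 0.
    Moreover t - e = t (1 - e) - (1 - t) e is nilpotent. Dividing one factor t
    out of e yields the inverse. *)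
Lemma subsqr_strongly_drazin t :
  nilpotent_elt (t - t ^+ 2) -> has_strongly_drazin_inverse t.
Proof.
move=> [n tn]; pose N := n.+1; pose u := 1 - t.
have comm_t1B v : GRing.comm t v -> GRing.comm t (1 - v).
  by move=> tv; apply: commrB => //; exact: commr1.
have tu : GRing.comm t u by exact: comm_t1B.
have tuN : t ^+ N * u ^+ N = 0.
  by rewrite -exprMn_comm// mulrBr mulr1 exprSr tn mul0r.
pose f := (1 - t ^+ N) ^+ N; pose e := 1 - f.
have tf : GRing.comm t f by apply/commrX/comm_t1B/commrX.
have te : GRing.comm t e by exact: comm_t1B.
have ef : GRing.comm e f.
  by apply/commr_sym/commrB => //; exact: commr1.
have [p tp eE] : exists2 p, GRing.comm t p & e = t ^+ N * p.
  exists (\sum_(i < N) (1 - t ^+ N) ^+ i).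
    by apply: commr_sum => i _; apply/commrX/comm_t1B/commrX.
  rewrite /e -[1 - f]opprB subrX1 -mulNr opprB opprB; congr (_ * _).
  by rewrite addrC subrK.
have [q uq fE] : exists2 q, GRing.comm u q & f = u ^+ N * q.
  exists ((\sum_(i < N) t ^+ i) ^+ N).
    by apply/commrX/commr_sum => i _; apply/commrX/commr_sym.
  rewrite /f -[1 - t ^+ N]opprB subrX1 -mulNr opprB exprMn_comm//.
  by apply: commr_sum => i _; apply/commrX/commr_sym.
have tNf : t ^+ N * f = 0 by rewrite fE mulrA tuN mul0r.
have ef0 : e * f = 0.
  rewrite eE -mulrA -(_ : f * p = p * f) ?mulrA ?tNf ?mul0r//.
  have pf : GRing.comm p f.
    by apply/commrX/commrB; [exact: commr1|apply/commrX/commr_sym].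
  by rewrite pf.
have ee : e * e = e.
  by rewrite {2}/e mulrBr mulr1 ef0 subr0.
have uNe : u ^+ N * e = 0.
  have -> : u ^+ N * e = t ^+ N * u ^+ N * p.
    rewrite eE mulrA; congr (_ * _).
    by apply: commrX; apply/commr_sym/commrX.
  by rewrite tuN mul0r.
have ue : GRing.comm u e.
  by apply/commr_sym/commrB; [exact: commr1|apply: commr_sym].
pose y := t ^+ n * p.
have ty : GRing.comm t y by apply: commrM => //; exact: commrX.
have eEy : e = t * y by rewrite eE exprS mulrA.
have tye : t * (y * e) = e by rewrite mulrA -eEy ee.
exists (y * e); split; rewrite ?tye.
- rewrite -mulrA -te mulrA.
  by rewrite -[in RHS]ty -eEy ee.
- by rewrite -[_ * t * _]mulrA tye -mulrA ee.
have -> : t - e = t * f + (- (u * e)).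
  have -> : f = 1 - e by rewrite /e subKr.
  by rewrite mulrBr mulr1 mulrBl mul1r [in RHS]opprB [RHS]addrA subrK.
apply: nilpotentD.
- have -> : t * f * - (u * e) = - (t * (u * (f * e))).
    rewrite mulrN -!mulrA; congr (- (t * _)); rewrite !mulrA; congr (_ * _).
    by apply/commr_sym/commrX/commrB; [exact: commr1|apply/commrX/commr_sym].
  by rewrite -[f * e]ef ef0 !mulr0 oppr0 mul0r.
- by exists N; rewrite exprMn_comm// /N exprSr [f ^+ _]exprS mulrA
    -[t ^+ n * t]exprSr tNf mul0r.
- exists N; rewrite exprNn exprMn_comm//.
  by rewrite [e ^+ _]exprS [u ^+ _ * _]mulrA uNe mul0r mulr0.
Qed.

Lemma strongly_drazin_hirano t :
  has_strongly_drazin_inverse t -> has_hirano_inverse t.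
Proof.
move=> [z [tz zE tn]]; exists z; split=> //.
have ee := drazin_idem zE; set e := t * z in tn ee *.
have te : GRing.comm t e by rewrite /GRing.comm /e {1}tz !mulrA.
rewrite -subrDM_idem//.
apply: nilpotentM_comm tn; apply: commrD; apply/commr_sym; exact: commrB.
Qed.

End Nilpotent.

(** * Two by two matrices over a ring *)

Section Matrix22.
Context (R : pzRingType).
Implicit Types a b c d : R.

Definition mx22 a b c d : 'M[R]_(1 + 1) := block_mx a%:M b%:M c%:M d%:M.

Lemma mx22M a b c d a' b' c' d' : mx22 a b c d * mx22 a' b' c' d' =
  mx22 (a * a' + b * c') (a * b' + b * d') (c * a' + d * c') (c * b' + d * d').
Proof.
by rewrite -mulmxE /mx22 mulmx_block -!scalar_mxM -!raddfD.
Qed.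

Lemma mx22D a b c d a' b' c' d' : mx22 a b c d + mx22 a' b' c' d' =
  mx22 (a + a') (b + b') (c + c') (d + d').
Proof. by rewrite /mx22 add_block_mx -!raddfD. Qed.

Lemma mx22N a b c d : - mx22 a b c d = mx22 (- a) (- b) (- c) (- d).
Proof. by rewrite /mx22 opp_block_mx -!raddfN. Qed.

Lemma mx22_0 : mx22 0 0 0 0 = 0.
Proof. by rewrite /mx22 !raddf0 block_mx0. Qed.

Lemma mx22_diagX a d n : mx22 a 0 0 d ^+ n.+1 = mx22 (a ^+ n.+1) 0 0 (d ^+ n.+1).
Proof.
elim: n => [|n IH]; first by rewrite !expr1.
by rewrite exprSr IH mx22M !mul0r !mulr0 !addr0 add0r -!exprSr.
Qed.

Lemma mx22_diag_nilpotent a d :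
  nilpotent_elt a -> nilpotent_elt d -> nilpotent_elt (mx22 a 0 0 d).
Proof.
move=> [m am] [n dn]; exists (m + n).+1.
by rewrite mx22_diagX !exprSr !exprD am dn !(mul0r, mulr0) mx22_0.
Qed.

Lemma mx22_antidiag_nilpotent b c :
  nilpotent_elt (b * c) -> nilpotent_elt (mx22 0 b c 0).
Proof.
move=> [n bcn].
have cbX k : (c * b) ^+ k.+1 = c * (b * c) ^+ k * b.
  elim: k => [|k IH]; first by rewrite expr1 expr0 mulr1.
  by rewrite exprSr IH exprSr !mulrA.
have [k tk] : nilpotent_elt (mx22 0 b c 0 ^+ 2).
  rewrite expr2 mx22M !mul0r !mulr0 !addr0 add0r.
  apply: mx22_diag_nilpotent; first by exists n.
  by exists n.+1; rewrite cbX bcn mulr0 mul0r.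
by exists (2 * k)%N; rewrite exprM.
Qed.

(** The diagonal entries are split off one at a time; the order of the
    summands is what makes their products vanish although c couples them. *)
Lemma mx22_lower_subsqr_nilpotent a c d :
  nilpotent_elt (a - a ^+ 2) -> nilpotent_elt (d - d ^+ 2) ->
  nilpotent_elt (mx22 a 0 c d - mx22 a 0 c d ^+ 2).
Proof.
move=> an dn.
have diagE x y : mx22 x 0 0 y - mx22 x 0 0 y ^+ 2
    = mx22 (x - x ^+ 2) 0 0 (y - y ^+ 2).
  by rewrite mx22_diagX mx22N mx22D !subr0.
have n0 : nilpotent_elt (0 - 0 ^+ 2 : R).
  by apply: nilpotent_subsqr; exact: nilpotent0.
have -> : mx22 a 0 c d = mx22 a 0 0 0 + (mx22 0 0 c 0 + mx22 0 0 0 d).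
  by rewrite !mx22D !add0r !addr0.
apply: nilpotent_subsqrD.
- by rewrite mx22D mx22M !(mul0r, mulr0, addr0) mx22_0.
- by rewrite diagE; apply: mx22_diag_nilpotent.
apply: nilpotent_subsqrD.
- by rewrite mx22M !(mul0r, mulr0, addr0) mx22_0.
- apply/nilpotent_subsqr/mx22_antidiag_nilpotent.
  by rewrite mul0r; exact: nilpotent0.
- by rewrite diagE; apply: mx22_diag_nilpotent.
Qed.

(** The first column is split along the idempotent e, which stands for
    A A^D. All that keeps a from being nilpotent lies in a e, and b c e = 0
    together with b d = 0 decouples a e and d from the nilpotent part. *)
Lemma mx22_subsqr_nilpotent a b c d e :
  e * e = e -> GRing.comm a e ->
  nilpotent_elt (a - a * e) -> nilpotent_elt (a - a ^+ 2) ->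
  nilpotent_elt (d - d ^+ 2) ->
  b * d = 0 -> e * b * c = b * c -> b * c * e = 0 ->
  nilpotent_elt (mx22 a b c d - mx22 a b c d ^+ 2).
Proof.
move=> ee ae a1n aan ddn bd ebc bce.
have -> : mx22 a b c d =
    (mx22 (a - a * e) 0 0 0 + mx22 0 b (c - c * e) 0) + mx22 (a * e) 0 (c * e) d.
  by rewrite !mx22D !add0r !addr0 !subrK.
have aeae : a * e * (a * e) = a ^+ 2 * e.
  by rewrite mulrA -[a * e * a]mulrA -ae -!mulrA ee.
have bc1 : b * (c - c * e) = b * c by rewrite mulrBr !mulrA bce subr0.
apply: nilpotent_subsqrD.
- rewrite mx22D mx22M !(mul0r, mulr0, addr0, add0r) bd.
  have xee x : (x - x * e) * (a * e) = 0.
    by rewrite ae mulrA mulrBl -[x * e * e]mulrA ee subrr mul0r.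
  by rewrite !xee !mulrA bce addr0 mx22_0.
- apply: nilpotent_subsqr; apply: nilpotentD.
  + rewrite mx22D !mx22M !(mul0r, mulr0, addr0, add0r) -mulrA bc1.
    have -> : (a - a * e) * (b * c) = 0.
      by rewrite mulrBl -[a * e * _]mulrA [e * _]mulrA ebc subrr.
    by rewrite mx22_0.
  + by apply: mx22_diag_nilpotent; last exact: nilpotent0.
  + apply: mx22_antidiag_nilpotent; rewrite bc1.
    by exists 2%N; rewrite expr2 -{2}ebc !mulrA bce !mul0r.
- apply: mx22_lower_subsqr_nilpotent => //.
  have -> : a * e - (a * e) ^+ 2 = (a - a ^+ 2) * e.
    by rewrite expr2 aeae mulrBl.
  apply: nilpotentM_comm aan; apply/commr_sym/commrB; first exact: commr_sym.
  exact/commrX/commr_sym.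
Qed.

End Matrix22.

Theorem theorem2p10 (K : numFieldType) (X : completeNormedModType K)
    (A B C D : 'L(X)) :
  has_strongly_drazin_inverse A ->
  has_strongly_drazin_inverse D ->
  drazin A * B * C * drazin A = 0 ->
  drazin A * B * D = 0 ->
  spectral_idem A * B * C = 0 ->
  spectral_idem A * B * D = 0 ->
  has_hirano_inverse (block_mx A%:M B%:M C%:M D%:M : 'M['L(X)]_(1 + 1)).
Proof.
move=> [Z AZ] [Y DY]; have AD := strongly_drazin_is_drazin AZ.
rewrite /spectral_idem (drazinE AD) => ZBCZ ZBD piBC piBD.
have [tz zE An] := AD; pose E := A * Z.
have EBC : E * B * C = B * C.
  by apply/esym/eqP; rewrite -subr_eq0 -{1}[B]mul1r -!mulrBl piBC.
have EBD : E * B * D = B * D.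
  by apply/esym/eqP; rewrite -subr_eq0 -{1}[B]mul1r -!mulrBl piBD.
apply/strongly_drazin_hirano/subsqr_strongly_drazin.
apply: (@mx22_subsqr_nilpotent _ A B C D E).
- exact: drazin_idem.
- by rewrite /GRing.comm /E {1}tz !mulrA.
- by rewrite /E mulrA.
- exact: strongly_drazin_subsqr AZ.
- exact: strongly_drazin_subsqr DY.
- by rewrite -EBD /E -!mulrA [Z * _]mulrA ZBD mulr0.
- exact: EBC.
- have -> : B * C * E = A * (Z * B * C * Z) * A.
    by rewrite -EBC {2}/E tz /E !mulrA.
  by rewrite ZBCZ mulr0 mul0r.
Qed.
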